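(* Let $\mathbf k$ be an algebraically closed field of characteristic zero. For every finite group $\Gamma$ there exist $n\ge1$ and a monomial ideal $I\subset\mathbf k[\mathbf x]=\mathbf k[x_1,\dots,x_n]$ with cofinite support such that $$\operatorname{Aut}_{\mathbf k}(\mathbf k[\mathbf x]/I)\big/\operatorname{Aut}^0_{\mathbf k}(\mathbf k[\mathbf x]/I)\cong\Gamma.$$ Moreover, $I$ may be chosen so that $\operatorname{Aut}_{\mathbf k}(\mathbf k[\mathbf x]/I)\cong\operatorname{Aut}^0_{\mathbf k}(\mathbf k[\mathbf x]/I)\rtimes\Gamma$ and $\operatorname{Aut}^0_{\mathbf k}(\mathbf k[\mathbf x]/I)$ is solvable.
   Context: A monomial ideal $I\subset\mathbf k[x_1,\dots,x_n]$ (an ideal generated by monomials) has cofinite support if only finitely many monomials lie outside $I$, equivalently $\dim_{\mathbf k}\mathbf k[\mathbf x]/I<\infty$. Then $\operatorname{Aut}_{\mathbf k}(\mathbf k[\mathbf x]/I)$, the group of $\mathbf k$-algebra automorphisms, is a linear algebraic group, and $\operatorname{Aut}^0_{\mathbf k}(\mathbf k[\mathbf x]/I)$ denotes its identity component. *)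

(* Defs.v *)
From HB Require Import structures.
From mathcomp Require Import all_boot all_order all_algebra.
From mathcomp Require Import fingroup generic_quotient ring_quotient.
From mathcomp Require Import mpoly.
From mathcomp Require Import boolp classical_sets cardinality topology.

Set Implicit Arguments.
Unset Strict Implicit.
Unset Printing Implicit Defensive.

Import GRing.Theory.
Local Open Scope classical_set_scope.
Local Open Scope ring_scope.

(* ring_quotient only gives {ideal_quot I} a commutative ring structure; when R
   is a commutative k-algebra we add the induced scalar multiplication.       *)
Section QuotientAlgebra.
Local Open Scope quotient_scope.
Variables (k : comNzRingType) (R : comAlgType k) (I : idealr R).
Local Notation Q := {ideal_quot I}.

Definition quot_scale (c : k) (u : Q) : Q := \pi_Q (c%:A) * u.

Fact quot_scaleA c d u : quot_scale c (quot_scale d u) = quot_scale (c * d) u.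
Proof. by rewrite /quot_scale mulrA -rmorphM /= -scalerAl mul1r scalerA. Qed.

Fact quot_scale1 : left_id 1 quot_scale.
Proof. by move=> u; rewrite /quot_scale scale1r rmorph1 mul1r. Qed.

Fact quot_scaleDr : right_distributive quot_scale +%R.
Proof. by move=> c u v; rewrite /quot_scale mulrDr. Qed.

Fact quot_scaleDl u : {morph quot_scale^~ u : c d / c + d}.
Proof. by move=> c d; rewrite /quot_scale scalerDl rmorphD mulrDl. Qed.

HB.instance Definition _ := GRing.Zmodule_isLmodule.Build k Q
  quot_scaleA quot_scale1 quot_scaleDr quot_scaleDl.

Fact quot_scaleAl c (u v : Q) : c *: (u * v) = (c *: u) * v.
Proof. exact: mulrA. Qed.

HB.instance Definition _ := GRing.Lmodule_isLalgebra.Build k Q quot_scaleAl.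
HB.instance Definition _ := GRing.Lalgebra_isComAlgebra.Build k Q.

Fact pi_quot_scale c (r : R) : \pi_Q (c *: r) = c *: \pi_Q r.
Proof. by rewrite -[in LHS](mul1r r) scalerAl rmorphM. Qed.

End QuotientAlgebra.

Section MonomialIdeals.
Variables (k : fieldType) (n : nat).
Implicit Type I : idealr {mpoly k[n]}.

Definition gen_ideal (R : comNzRingType) (S : set R) : set R :=
  [set p | exists s : seq (R * R),
     (forall u, u \in s -> S u.2) /\ p = \sum_(u <- s) u.1 * u.2].

Definition monomial_ideal I : Prop :=
  exists M : set 'X_{1..n},
    [set p | p \in I] = gen_ideal [set ('X_[m] : {mpoly k[n]}) | m in M].

Definition cofinite_support I : Prop :=
  finite_set [set m : 'X_{1..n} | ('X_[m] : {mpoly k[n]}) \notin I].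

End MonomialIdeals.

Section Groups.
Local Open Scope group_scope.

Definition group_iso (G H : groupType) (f : G -> H) : Prop :=
  {morph f : x y / x * y} /\ bijective f.

Definition isomorphic (G H : groupType) : Prop :=
  exists f : G -> H, group_iso f.

Definition is_subgroup (G : groupType) (H : set G) : Prop :=
  H 1 /\ forall x y, H x -> H y -> H (x / y).

Definition generated (G : groupType) (S : set G) : set G :=
  smallest (@is_subgroup G) S.

Fixpoint derived_series (G : groupType) (i : nat) {struct i} : set G :=
  if i is j.+1 then
    generated [set [~ x, y] | x in @derived_series G j & y in @derived_series G j]
  else [set: G].

Definition solvable_group (G : groupType) : Prop :=
  exists i, @derived_series G i = [set 1].

Record normal_subgroup (G : groupType) := NormalSubgroup {
  nsub_set : set G;
  nsub_subgroup : is_subgroup nsub_set;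
  nsub_conj : forall x y, nsub_set x -> nsub_set (x ^ y)
}.

Section Sub.
Variables (G : groupType) (N : normal_subgroup G).

Definition subg_type : Type := {x : G | x \in nsub_set N}.

Fact nsub_closed : group_closed (fun x : G => x \in nsub_set N).
Proof.
have [N1 Ndiv] := nsub_subgroup N.
by split=> [|x y]; rewrite -!topredE /= ?inE //; exact: Ndiv.
Qed.

HB.instance Definition _ := [isSub of subg_type for @sval G _].
HB.instance Definition _ := [Choice of subg_type by <:].
HB.instance Definition _ :=
  SubChoice_isSubGroup.Build G (fun x => x \in nsub_set N) subg_type nsub_closed.

End Sub.

Section Quotient.
Local Open Scope quotient_scope.
Variables (G : groupType) (N : normal_subgroup G).

Definition coset_equiv (x y : G) : bool := (x^-1 * y) \in nsub_set N.

Fact coset_equiv_is_equiv : equiv_class_of coset_equiv.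
Proof.
have [N1 Ndiv] := nsub_subgroup N.
have NV x : nsub_set N x -> nsub_set N x^-1 by move=> Nx; rewrite -[_^-1]mul1g; apply: Ndiv.
have NM x y : nsub_set N x -> nsub_set N y -> nsub_set N (x * y).
  by move=> Nx Ny; rewrite -[y]invgK; apply/Ndiv/NV.
split=> [x|x y|y x z].
- by rewrite /coset_equiv mulVg inE.
- apply/idP/idP; rewrite /coset_equiv !inE => /NV; by rewrite invgM invgK.
- rewrite /coset_equiv !inE => xy yz; have := NM _ _ xy yz.
  by rewrite -mulgA mulKVg.
Qed.

Canonical coset_equiv_rel := EquivRelPack coset_equiv_is_equiv.
Canonical coset_encModRel := defaultEncModRel coset_equiv.

Definition quotient_group : Type := {eq_quot coset_equiv}.
HB.instance Definition _ := EqQuotient.on quotient_group.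
HB.instance Definition _ := Choice.on quotient_group.
Local Notation Q := quotient_group.

Definition quotg_one : Q := \pi_Q 1.
Definition quotg_mul (u v : Q) : Q := \pi_Q (repr u * repr v).
Definition quotg_inv (u : Q) : Q := \pi_Q (repr u)^-1.

Fact pi_quotgM x y : quotg_mul (\pi x) (\pi y) = \pi_Q (x * y).
Proof.
rewrite /quotg_mul; apply/eqP; rewrite eqmodE /= /coset_equiv inE.
have [N1 Ndiv] := nsub_subgroup N.
have xx : nsub_set N ((repr (\pi_Q x))^-1 * x).
  have /eqP : \pi_Q (repr (\pi_Q x)) = \pi_Q x by rewrite reprK.
  by rewrite eqmodE /= /coset_equiv inE.
have yy : nsub_set N ((repr (\pi_Q y))^-1 * y).
  have /eqP : \pi_Q (repr (\pi_Q y)) = \pi_Q y by rewrite reprK.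
  by rewrite eqmodE /= /coset_equiv inE.
move: (repr (\pi_Q x)) (repr (\pi_Q y)) xx yy => x' y' /nsub_conj-/(_ y) xx yy.
have yx : nsub_set N ((y'^-1 * y) / ((x'^-1 * x) ^ y)^-1).
  by apply: (Ndiv _ _ yy); rewrite -[_^-1]mul1g; apply: Ndiv.
by move: yx; rewrite invgK conjgE !mulgA mulgK invgM.
Qed.

Fact pi_quotgV x : quotg_inv (\pi x) = \pi_Q x^-1.
Proof.
rewrite /quotg_inv; apply/eqP; rewrite eqmodE /= /coset_equiv inE.
have /eqP : \pi_Q x = \pi_Q (repr (\pi_Q x)) by rewrite reprK.
rewrite eqmodE /= /coset_equiv inE => /nsub_conj-/(_ (repr (\pi_Q x))^-1).
by rewrite conjgE !invgK mulgA mulgA mulgK.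
Qed.

Fact quotg_mulA : associative quotg_mul.
Proof.
by move=> u v w; rewrite -[u]reprK -[v]reprK -[w]reprK !pi_quotgM mulgA.
Qed.

Fact quotg_mul1g : left_id quotg_one quotg_mul.
Proof. by move=> u; rewrite -[u]reprK pi_quotgM mul1g. Qed.

Fact quotg_mulg1 : right_id quotg_one quotg_mul.
Proof. by move=> u; rewrite -[u]reprK pi_quotgM mulg1. Qed.

Fact quotg_mulVg : left_inverse quotg_one quotg_inv quotg_mul.
Proof. by move=> u; rewrite -[u]reprK pi_quotgV pi_quotgM mulVg. Qed.

Fact quotg_mulgV : right_inverse quotg_one quotg_inv quotg_mul.
Proof. by move=> u; rewrite -[u]reprK pi_quotgV pi_quotgM mulgV. Qed.

HB.instance Definition _ := isGroup.Build quotient_group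
  quotg_mulA quotg_mul1g quotg_mulg1 quotg_mulVg quotg_mulgV.

End Quotient.

Record group_action (H N : groupType) := GroupAction {
  gact : H -> N -> N;
  gact1 : forall x, gact 1 x = x;
  gactM : forall a b x, gact (a * b) x = gact a (gact b x);
  gact_morph : forall a x y, gact a (x * y) = gact a x * gact a y
}.

Definition semidirect (H N : groupType) (theta : group_action H N) : Type :=
  (N * H)%type.

Section SemidirectProduct.
Variables (H N : groupType) (theta : group_action H N).
Local Notation "a .: x" := (gact theta a x) (at level 30).
Local Notation semidirect := (semidirect theta).

HB.instance Definition _ := Choice.copy semidirect (N * H)%type.

Definition sd_one : semidirect := (1, 1).
Definition sd_mul (u v : semidirect) : semidirect :=
  (u.1 * (u.2 .: v.1), u.2 * v.2).
Definition sd_inv (u : semidirect) : semidirect :=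
  (u.2^-1 .: u.1^-1, u.2^-1).

Fact gact_1 a : a .: 1 = 1.
Proof.
by apply: (@mulgI _ (a .: 1)); rewrite -gact_morph !mulg1.
Qed.

Fact sd_mulA : associative sd_mul.
Proof.
by move=> u v w; rewrite /sd_mul /= gact_morph gactM !mulgA.
Qed.

Fact sd_mul1g : left_id sd_one sd_mul.
Proof. by case=> x a; rewrite /sd_mul /= gact1 !mul1g. Qed.

Fact sd_mulg1 : right_id sd_one sd_mul.
Proof. by case=> x a; rewrite /sd_mul /= gact_1 !mulg1. Qed.

Fact sd_mulVg : left_inverse sd_one sd_inv sd_mul.
Proof.
by case=> x a; rewrite /sd_mul /= -gact_morph !mulVg gact_1.
Qed.

Fact sd_mulgV : right_inverse sd_one sd_inv sd_mul.
Proof.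
by case=> x a; rewrite /sd_mul /= -gactM !mulgV gact1 mulgV.
Qed.

HB.instance Definition _ := isGroup.Build semidirect
  sd_mulA sd_mul1g sd_mulg1 sd_mulVg sd_mulgV.

End SemidirectProduct.
End Groups.

Section Automorphisms.
Variables (k : closedFieldType) (A : comAlgType k).

Definition is_alg_aut (f : A -> A) : Prop :=
  [/\ linear f, GRing.monoid_morphism f & bijective f].

Record alg_aut := AlgAut {
  aut_val :> A -> A;
  aut_valP : `[< is_alg_aut aut_val >]
}.

HB.instance Definition _ := [isSub for aut_val].
HB.instance Definition _ := [Choice of alg_aut by <:].

Lemma alg_autP (f : alg_aut) : is_alg_aut f.
Proof. by case: f => f /= /asboolP. Qed.

Lemma alg_aut_ext (f g : alg_aut) : f =1 g -> f = g.
Proof. by move=> fg; apply/val_inj/funext. Qed.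

Fact aut_one_subproof : `[< is_alg_aut idfun >].
Proof. by apply/asboolP; split=> //; exists idfun. Qed.
Definition aut_one := AlgAut aut_one_subproof.

Fact aut_mul_subproof (f g : alg_aut) : `[< is_alg_aut (f \o g) >].
Proof.
apply/asboolP; have [fL [f1 fM] fB] := alg_autP f.
have [gL [g1 gM] gB] := alg_autP g.
split; last exact: bij_comp.
- by move=> a u v /=; rewrite gL fL.
- by split=> [|u v] /=; rewrite ?g1 ?f1 // gM fM.
Qed.
Definition aut_mul f g := AlgAut (aut_mul_subproof f g).

Fact aut_inv_ex (f : alg_aut) : exists g : alg_aut, cancel f g /\ cancel g f.
Proof.
have [fL [f1 fM] [g fK gK]] := alg_autP f.
have gP : `[< is_alg_aut g >].
  apply/asboolP; split; last by exists f.
  - by move=> a u v; apply: (can_inj fK); rewrite gK fL !gK.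
  - by split=> [|u v]; apply: (can_inj fK); rewrite ?gK ?f1 ?fM ?gK.
by exists (AlgAut gP).
Qed.
Definition aut_inv f := sval (cid (aut_inv_ex f)).

Fact aut_mulA : associative aut_mul.
Proof. by move=> f g h; apply: alg_aut_ext. Qed.
Fact aut_mul1g : left_id aut_one aut_mul.
Proof. by move=> f; apply: alg_aut_ext. Qed.
Fact aut_mulg1 : right_id aut_one aut_mul.
Proof. by move=> f; apply: alg_aut_ext. Qed.
Fact aut_mulVg : left_inverse aut_one aut_inv aut_mul.
Proof.
move=> f; apply: alg_aut_ext => x; rewrite /aut_inv /=.
by case: cid => g /= [fK _]; rewrite fK.
Qed.
Fact aut_mulgV : right_inverse aut_one aut_inv aut_mul.
Proof.
move=> f; apply: alg_aut_ext => x; rewrite /aut_inv /=.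
by case: cid => g /= [_ gK]; rewrite gK.
Qed.

HB.instance Definition _ := isGroup.Build alg_aut
  aut_mulA aut_mul1g aut_mulg1 aut_mulVg aut_mulgV.

(* The polynomial functions in the matrix entries of an automorphism, written
   without choosing a basis of A.  The inverse of the determinant can be left
   out: it does not change which subsets are zero loci.  When A is finite
   dimensional, zariski_open is thus the topology of the linear algebraic group
   alg_aut A inside GL(A).                                                    *)
Inductive regular_fun : (alg_aut -> k) -> Prop :=
| RegularConst (c : k) : regular_fun (fun=> c)
| RegularEntry (l : {scalar A}) (a : A) : regular_fun (fun f => l (f a))
| RegularAdd p q : regular_fun p -> regular_fun q ->
    regular_fun (fun f => p f + q f)
| RegularMul p q : regular_fun p -> regular_fun q ->
    regular_fun (fun f => p f * q f).

Definition zero_locus (P : set (alg_aut -> k)) : set alg_aut :=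
  [set f | forall p, P p -> p f = 0].

Definition zariski_open (U : set alg_aut) : Prop :=
  exists P : set (alg_aut -> k), P `<=` regular_fun /\ U = ~` zero_locus P.

Fact zariski_openP U : zariski_open U <->
  forall f, U f -> exists p,
    [/\ regular_fun p, p f != 0 & forall g, p g != 0 -> U g].
Proof.
split=> [[P [Preg ->]] f /= /existsNP[p /not_implyP[Pp /eqP pf]]|UP].
  exists p; split=> // [|g pg]; first exact: Preg.
  by move=> /(_ p Pp) /eqP; apply/negP.
exists [set p | regular_fun p /\ forall g, p g != 0 -> U g].
split=> [p []//|]; apply/seteqP; split=> f.
  by move=> /UP[p [rp pf pU]] /(_ p (conj rp pU))/eqP; apply/negP.
by move=> /= /existsNP[p /not_implyP[[_ pU] /eqP]]; exact: pU.
Qed.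

Fact zariski_openT : zariski_open setT.
Proof.
apply/zariski_openP => f _; exists (fun=> 1); split=> //; last exact: oner_neq0.
exact: RegularConst.
Qed.

Fact zariski_openI : setI_closed zariski_open.
Proof.
move=> U V /zariski_openP UP /zariski_openP VP; apply/zariski_openP => f [].
move=> /UP[p [rp pf pU]] /VP[q [rq qf qV]].
exists (fun f => p f * q f); split; first exact: RegularMul.
  by rewrite mulf_neq0.
by move=> g; rewrite mulf_eq0 negb_or => /andP[/pU ? /qV].
Qed.

Fact zariski_open_bigU (J : Type) (U : J -> set alg_aut) :
  (forall j, zariski_open (U j)) -> zariski_open (\bigcup_j U j).
Proof.
move=> UP; apply/zariski_openP => f [j _] /((zariski_openP _).1 (UP j)).
by move=> [p [rp pf pU]]; exists p; split=> // g /pU; exists j.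
Qed.

HB.instance Definition _ :=
  isOpenTopological.Build alg_aut zariski_openT zariski_openI zariski_open_bigU.

Lemma zariski_openE : open = zariski_open.
Proof. by []. Qed.

Local Open Scope group_scope.

Lemma regular_mull (h : alg_aut) p :
  regular_fun p -> regular_fun (fun f => p (h * f)).
Proof.
elim=> [c|l a|q r _ ? _ ?|q r _ ? _ ?].
- exact: RegularConst.
- have [hL _ _] := alg_autP h.
  pose lh x : k := l (h x).
  have lhP : scalar lh by move=> c u v; rewrite /lh hL linearP.
  pose lhm : {scalar A} :=
    HB.pack lh (GRing.isLinear.Build k A k *%R lh lhP).
  exact: (RegularEntry lhm a).
- exact: RegularAdd.
- exact: RegularMul.
Qed.

Lemma regular_mulr (h : alg_aut) p :
  regular_fun p -> regular_fun (fun f => p (f * h)).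
Proof.
elim=> [c|l a|q r _ ? _ ?|q r _ ? _ ?].
- exact: RegularConst.
- exact: (RegularEntry l (h a)).
- exact: RegularAdd.
- exact: RegularMul.
Qed.

Lemma continuous_mull (h : alg_aut) : continuous (fun f : alg_aut => h * f).
Proof.
apply/continuousP => U; rewrite zariski_openE => /zariski_openP UP.
apply/zariski_openP => f /UP[p [rp pf pU]].
exists (fun f => p (h * f)); split=> // [|g /pU//]; exact: regular_mull.
Qed.

Lemma continuous_mulr (h : alg_aut) : continuous (fun f : alg_aut => f * h).
Proof.
apply/continuousP => U; rewrite zariski_openE => /zariski_openP UP.
apply/zariski_openP => f /UP[p [rp pf pU]].
exists (fun f => p (f * h)); split=> // [|g /pU//]; exact: regular_mulr.
Qed.

Definition aut0_set : set alg_aut := connected_component [set: alg_aut] 1.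

Lemma aut0_stable (F : alg_aut -> alg_aut) f :
  continuous F -> aut0_set f -> F f = 1 -> F @` aut0_set `<=` aut0_set.
Proof.
move=> cF f0 Ff; apply: connected_component_max => //; first by exists f.
apply: connected_continuous_connected; first exact: component_connected.
exact: continuous_subspaceT.
Qed.

Fact aut0_subgroup : is_subgroup aut0_set.
Proof.
have A1 : aut0_set 1 by exact: connected_component_refl.
split=> // f g f0 g0; have /= := @aut0_stable (fun f => f * g^-1) g _ g0 (mulgV g).
apply; first exact: continuous_mulr.
by exists f.
Qed.

Fact aut0_conj f g : aut0_set f -> aut0_set (f ^ g).
Proof.
move=> f0.
have A1 : aut0_set 1 by exact: connected_component_refl.
apply: (@aut0_stable (fun f => g^-1 * (f * g)) 1 _ A1 _); last by exists f.
- move=> x; apply: continuous_comp; first exact: continuous_mulr.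
  exact: continuous_mull.
- by rewrite mul1g mulVg.
Qed.

Definition aut0 : normal_subgroup alg_aut := NormalSubgroup aut0_subgroup aut0_conj.

End Automorphisms.

(* Main.v *)
Require Import Defs.
From HB Require Import structures.
From mathcomp Require Import all_boot all_order all_algebra.
From mathcomp Require Import fingroup generic_quotient ring_quotient.
From mathcomp Require Import mpoly.
From mathcomp Require Import boolp classical_sets cardinality topology.
From mathcomp Require Import zify ring.

Set Implicit Arguments.
Unset Strict Implicit.
Unset Printing Implicit Defensive.

Import GRing.Theory.
Local Open Scope ring_scope.

(** The ideal is built from the Cayley colouring of the complete digraph on the
    given group.  Take one variable x_g for each group element g, put N for the
    order of the group and D = 2N + 2, and give every c <> 1 its own exponent
    w(c) in [1, N].  The ideal I contains every monomial of degree > D, no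
    monomial of degree < D, and all monomials of degree D except the
      x_g ^ w(g^-1 h) * x_h ^ (D - w(g^-1 h)),   g <> h.
    Since w < D - w, such a monomial remembers the ordered pair (g, h) up to
    left translation.

    Let phi be an automorphism of A = k[x]/I and let l be the linear part of
    phi(x_g).  Raising to the power D kills all higher terms, and x_g ^ D lies
    in I, so l ^ D lies in I.  In characteristic 0 its coefficient on a monomial
    x_a ^ w * x_b ^ (D - w) outside I is a nonzero multiple of
    l_a ^ w * l_b ^ (D - w); any two variables share such a monomial, so l has a
    single nonzero entry ([alg_aut_leading]): phi(x_g) = c_g x_{s(g)} + (terms of
    degree >= 2), with c_g <> 0.  As phi does not kill the surviving monomials of
    degree D, s preserves g^-1 h ([leading_colour]), hence s is a left
    translation ([alg_aut_translate]).  This gives a morphism from Aut(A) onto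
    the group, split by the translations of the variables.  Its kernel T
    consists of the automorphisms with phi(x_g) = c_g x_g + (terms of
    degree >= 2).

    It remains to see that T is the identity component and is solvable.  Because
    I contains everything above degree D, T imposes no condition on the terms of
    degree >= 2 ([alg_aut_triangular]); so the points of the affine line through
    1 and phi at which no diagonal coefficient vanishes stay in T, and a
    cofinite subset of a line is connected ([triangular_connected]).  The fibres
    of Aut(A) -> group are open because each is the locus where one matrix
    coefficient is nonzero ([shift_mcoord]), so the component does not leave T.
    Finally, commutators of T are congruent to the identity modulo degree 2, and
    each further commutator gains one degree ([derived_congruence]). *)

(** * The truncated monomial ideals and their quotient algebras *)

Lemma eq_pi_ideal (S : comNzRingType) (I : idealr S) (p q : S) :
  (\pi_{ideal_quot I}%qT p == \pi_{ideal_quot I}%qT q) = (p - q \in I).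
Proof. exact/esym/(Quotient.idealrBE I p q). Qed.

Section SocleIdeal.
Variables (k : closedFieldType) (n d : nat) (B : pred 'X_{1..n}).
Local Notation R := {mpoly k[n]}.
Implicit Types (m : 'X_{1..n}) (p q : R).

(** The monomials outside the ideal, which form a basis of the quotient.  The
    degree of the top layer is written [d.+2] so that 1 and the variables always
    survive, with no side condition on [d]. *)
Definition standard m := (mdeg m < d.+2)%N || (mdeg m == d.+2) && B m.

Lemma standard_lt m : (mdeg m < d.+2)%N -> standard m.
Proof. by rewrite /standard => ->. Qed.

Lemma standard_mdeg m : standard m -> (mdeg m <= d.+2)%N.
Proof. by case/orP=> [/ltnW//|/andP[/eqP->]]. Qed.

Lemma standardD m1 m2 : standard (m1 + m2)%MM -> standard m1.
Proof.
have [->|m2N0] := eqVneq m2 0%MM; first by rewrite addm0.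
move=> /standard_mdeg; rewrite mdegD => le; apply: standard_lt.
by apply: leq_trans le; rewrite -addn1 leq_add2l lt0n mdeg_eq0.
Qed.

Definition socle_pred : {pred R} :=
  fun p => all (fun m => ~~ standard m) (msupp p).

Lemma socle_predP p :
  reflect (forall m, standard m -> p@_m = 0) (p \in socle_pred).
Proof.
apply: (iffP allP) => /= [pI m ms|p0 m].
  apply/eqP; rewrite mcoeff_eq0; apply/negP => /pI; by rewrite ms.
by rewrite mcoeff_msupp; apply: contra => /p0 ->.
Qed.

Fact socle_idealr_closed : idealr_closed socle_pred.
Proof.
split.
- by apply/socle_predP => m _; rewrite mcoeff0.
- apply/negP => /socle_predP/(_ 0%MM); rewrite mcoeff1 eqxx standard_lt ?mdeg0 //.
  by move=> /(_ isT)/eqP; rewrite oner_eq0.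
- move=> p q r /allP /= qI /socle_predP rI; apply/socle_predP => m ms.
  rewrite mcoeffD rI // addr0; apply/eqP; rewrite mcoeff_eq0.
  apply/negP => /msuppM_le /allpairsP[[m1 m2] /= [_ /qI m2s mE]].
  by move: ms; rewrite mE addmC => /standardD; apply/negP.
Qed.

HB.instance Definition _ := isIdealr.Build R socle_pred socle_idealr_closed.
Definition socle_ideal : idealr R := socle_pred.

Lemma mem_socle_ideal p :
  reflect (forall m, standard m -> p@_m = 0) (p \in socle_ideal).
Proof. exact: socle_predP. Qed.

Lemma mpolyX_socle_ideal m : (('X_[m] : R) \in socle_ideal) = ~~ standard m.
Proof.
apply/mem_socle_ideal/idP => [H|/negP sm m' sm'].
  by apply/negP => /H; rewrite mcoeffX eqxx => /eqP; rewrite oner_eq0.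
by rewrite mcoeffX; case: eqP => [mE|//]; case: sm; rewrite mE.
Qed.

Lemma monomial_socle_ideal : monomial_ideal socle_ideal.
Proof.
exists [set m | ~~ standard m]%classic; apply/seteqP; split=> [p /=|p /= [s [sM ->]]].
  move=> /allP pI; exists [seq (p@_m *: 1, 'X_[m]) | m <- msupp p]; split.
    by move=> _ /mapP[m /pI ms ->] /=; exists m.
  rewrite big_map {1}[p]mpolyE; apply: eq_bigr => m _ /=.
  by rewrite -scalerAl mul1r.
rewrite big_seq; apply: rpred_sum => u /sM[m /= ms <-].
by apply: idealMr; rewrite mpolyX_socle_ideal.
Qed.

Lemma cofinite_socle_ideal : cofinite_support socle_ideal.
Proof.
have H : finite_set [set bmnm x | x in [set: 'X_{1..n < d.+3}]]%classic.
  by apply: finite_image; exact: finite_finset.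
apply: sub_finite_set H => m /=; rewrite mpolyX_socle_ideal negbK.
by move=> /standard_mdeg ms; exists (BMultinom (ms : (mdeg m < d.+3)%N)).
Qed.

(** Naming the quotient keeps a single canonical algebra structure on it:
    through the bare quotient type, unification meets competing ones. *)
Definition socle_alg : comAlgType k := {ideal_quot socle_ideal}.
Local Notation A := socle_alg.

Definition proj (p : R) : A := \pi_{ideal_quot socle_ideal}%qT p.
Definition rpoly (a : A) : R := repr (a : {ideal_quot socle_ideal}).

Lemma rpolyK : cancel rpoly proj.
Proof. by move=> a; exact: reprK. Qed.

Fact proj_is_linear : linear proj.
Proof. by move=> c p q; rewrite -pi_quot_scale -rmorphD. Qed.
Fact proj_is_monoid_morphism : GRing.monoid_morphism proj.
Proof. by split=> [|p q]; [exact: rmorph1 | exact: rmorphM]. Qed.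
HB.instance Definition _ := GRing.isLinear.Build k R A *:%R proj proj_is_linear.
HB.instance Definition _ :=
  GRing.isMonoidMorphism.Build R A proj proj_is_monoid_morphism.

Lemma proj_eq0 p : reflect (forall m, standard m -> p@_m = 0) (proj p == 0).
Proof.
have -> : (proj p == 0) = (p \in socle_ideal).
  by rewrite -(rmorph0 proj) [LHS](eq_pi_ideal socle_ideal) subr0.
exact: mem_socle_ideal.
Qed.

Definition mcoord m (a : A) : k := (rpoly a)@_m.

Lemma mcoord_proj m p : standard m -> mcoord m (proj p) = p@_m.
Proof.
move=> ms; apply/eqP; rewrite -subr_eq0 -mcoeffB; apply/eqP.
by move: m ms; apply/proj_eq0; rewrite rmorphB /= rpolyK subrr.
Qed.

Lemma mcoord_linear m : standard m -> scalar (mcoord m).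
Proof.
move=> ms c u v; rewrite -[u]rpolyK -[v]rpolyK -linearP.
by rewrite !mcoord_proj // mcoeffD mcoeffZ.
Qed.

Definition mcoord_form m (ms : standard m) : {scalar A} :=
  HB.pack (mcoord m) (GRing.isLinear.Build k A k *%R (mcoord m) (mcoord_linear ms)).

End SocleIdeal.

Arguments mcoord_form k {n d B m} ms.

(** * The degree filtration and algebra endomorphisms *)

HB.instance Definition _ (k : closedFieldType) (A : comAlgType k)
    (f : alg_aut A) :=
  GRing.isLinear.Build k A A *:%R (aut_val f)
    (let: And3 fL _ _ := alg_autP f in fL).
HB.instance Definition _ (k : closedFieldType) (A : comAlgType k)
    (f : alg_aut A) :=
  GRing.isMonoidMorphism.Build A A (aut_val f)
    (let: And3 _ fM _ := alg_autP f in fM).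

Lemma bij_alg_aut (k : closedFieldType) (A : comAlgType k)
    (f : {lrmorphism A -> A}) :
  bijective f -> exists phi : alg_aut A, phi =1 f.
Proof.
move=> fB; have fP : `[< is_alg_aut f >].
  apply/asboolP; split=> //; first exact: linearP.
  by split; [exact: rmorph1 | exact: rmorphM].
by exists (AlgAut fP).
Qed.

Section SocleAlgebra.
Variables (k : closedFieldType) (n d : nat) (B : pred 'X_{1..n}).
Local Notation R := {mpoly k[n]}.
Local Notation A := (socle_alg k d B).
Local Notation standard := (standard d B).
Implicit Types (m : 'X_{1..n}) (a b : A).

Lemma mcoordD m a b : standard m -> mcoord m (a + b) = mcoord m a + mcoord m b.
Proof. by move=> ms; exact: (raddfD (mcoord_form k ms) a b). Qed.

Lemma mcoordZ m c a : standard m -> mcoord m (c *: a) = c * mcoord m a.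
Proof. by move=> ms; exact: (linearZ_LR (mcoord_form k ms) c a). Qed.

Definition mon m : A := proj d B 'X_[m].
Definition var i : A := mon U_(i)%MM.

Lemma mcoord_mon m m' : standard m -> mcoord m (mon m') = (m' == m)%:R.
Proof. by move=> ms; rewrite mcoord_proj // mcoeffX. Qed.

Lemma mon_eq0 m : (mon m == 0) = ~~ standard m.
Proof.
apply/idP/idP => [/proj_eq0 H|/negP sm].
  by apply/negP => /H; rewrite mcoeffX eqxx => /eqP; rewrite oner_eq0.
apply/proj_eq0 => m' sm'; rewrite mcoeffX; case: eqP => [E|//].
by case: sm; rewrite E.
Qed.

Lemma monE m : mon m = \prod_i var i ^+ m i.
Proof.
rewrite /mon mpolyXE_id rmorph_prod /=.
by apply: eq_bigr => i _; rewrite rmorphXn.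
Qed.

Lemma alg_expand a :
  a = \sum_(m <- msupp (rpoly a) | standard m) mcoord m a *: mon m.
Proof.
rewrite -{1}[a]rpolyK {1}[rpoly a]mpolyE rmorph_sum /= big_mkcond [RHS]big_mkcond /=.
apply: eq_bigr => m _; rewrite linearZ /= -/(mon m); case: ifP => [ms|/negbT]; first by [].
by rewrite -mon_eq0 => /eqP ->; rewrite scaler0.
Qed.

(** The image in the quotient of the r-th power of the maximal ideal. *)
Definition filt r a := forall m, standard m -> (mdeg m < r)%N -> mcoord m a = 0.

Lemma filtW r s a : (r <= s)%N -> filt s a -> filt r a.
Proof. by move=> rs Fa m ms mr; apply: Fa => //; apply: leq_trans rs. Qed.

Lemma filt_eq0 r a : (d.+2 < r)%N -> filt r a -> a = 0.
Proof.
move=> dr Fa; rewrite [a]alg_expand big1 // => m ms.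
by rewrite Fa ?scale0r //; apply: leq_ltn_trans dr; exact: standard_mdeg ms.
Qed.

Lemma filt_zero r : filt r 0.
Proof. by move=> m ms _; rewrite -[0 in LHS](rmorph0 (proj d B)) mcoord_proj ?mcoeff0. Qed.

Lemma filt_lin r c a b : filt r a -> filt r b -> filt r (c *: a + b).
Proof.
by move=> Fa Fb m ms mr; rewrite mcoordD // mcoordZ // Fa // Fb // mulr0 addr0.
Qed.

Lemma filtD r a b : filt r a -> filt r b -> filt r (a + b).
Proof. by move=> Fa; rewrite -[a]scale1r; exact: filt_lin. Qed.

Lemma filtZ r c a : filt r a -> filt r (c *: a).
Proof. by move=> Fa; rewrite -[_ *: _]addr0; apply: filt_lin; last exact: filt_zero. Qed.

Lemma filtN r a : filt r a -> filt r (- a).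
Proof. by move=> Fa; rewrite -scaleN1r; exact: filtZ. Qed.

Lemma filtB r a b : filt r a -> filt r b -> filt r (a - b).
Proof. by move=> Fa /filtN; exact: filtD. Qed.

Lemma filt_sum r (I : Type) (s : seq I) (P : pred I) (F : I -> A) :
  (forall i, P i -> filt r (F i)) -> filt r (\sum_(i <- s | P i) F i).
Proof.
move=> H; elim/big_ind: _ => //; [exact: filt_zero|exact: filtD].
Qed.

Lemma filtM r s a b : filt r a -> filt s b -> filt (r + s) (a * b).
Proof.
move=> Fa Fb m ms mrs; rewrite -[a]rpolyK -[b]rpolyK -rmorphM mcoord_proj //.
apply/eqP; rewrite mcoeff_eq0; apply/negP.
move=> /msuppM_le/allpairsP[[m1 m2] /= [m1a m2b mE]]; move: ms mrs; rewrite mE.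
move=> ms; have s1 := standardD ms; move: ms; rewrite addmC => /standardD s2.
have {m1a} m1r : (r <= mdeg m1)%N.
  by rewrite leqNgt; apply/negP => /(Fa _ s1)/eqP; rewrite mcoeff_eq0 m1a.
have {m2b} m2s : (s <= mdeg m2)%N.
  by rewrite leqNgt; apply/negP => /(Fb _ s2)/eqP; rewrite mcoeff_eq0 m2b.
by rewrite addmC mdegD ltnNge (leq_add m1r m2s).
Qed.

Lemma filtX r a e : filt r a -> filt (e * r) (a ^+ e).
Proof.
move=> Fa; elim: e => [|e IH]; first by move=> m _; rewrite mul0n.
by rewrite exprS mulSn; exact: filtM.
Qed.

Lemma filtX1 a e : filt 1 a -> filt e (a ^+ e).
Proof. by move=> /filtX-/(_ e); rewrite muln1. Qed.

Lemma filt_mon m : filt (mdeg m) (mon m).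
Proof.
move=> m' ms'; rewrite mcoord_mon //; case: eqP => [->|//].
by rewrite ltnn.
Qed.

Lemma filt_var i : filt 1 (var i).
Proof. by have := @filt_mon U_(i)%MM; rewrite mdeg1. Qed.

Lemma filt_expand r a : filt r a ->
  a = \sum_(m <- msupp (rpoly a) | (r <= mdeg m)%N) mcoord m a *: mon m.
Proof.
move=> Fa; rewrite {1}[a]alg_expand big_mkcond [RHS]big_mkcond /=.
apply: eq_bigr => m _; case: (boolP (standard m)) => [ms|].
  by case: leqP => // mr; rewrite Fa // scale0r.
by rewrite -mon_eq0 => /eqP ->; rewrite scaler0 if_same.
Qed.

(** Multiplicative perturbation: replacing factors of order 1 by others that
    agree up to order r + 1 changes a product of degree e in order e + r only. *)
Lemma filt_prodB r m (u v : 'I_n -> A) :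
    (forall i, filt 1 (u i)) -> (forall i, filt 1 (v i)) ->
    (forall i, filt r.+1 (u i - v i)) ->
  filt (mdeg m + r) (\prod_i u i ^+ m i - \prod_i v i ^+ m i).
Proof.
move=> Fu Fv Fuv; pose P t a b := [/\ filt t a, filt t b & filt (t + r) (a - b)].
have PM s t a b a' b' : P s a b -> P t a' b' -> P (s + t)%N (a * a') (b * b').
  move=> [Fa Fb Fab] [Fa' Fb' Fab']; split; try exact: filtM.
  have -> : a * a' - b * b' = a * (a' - b') + (a - b) * b'.
    by rewrite mulrBr mulrBl addrA subrK.
  by apply: filtD; [rewrite -addnA|rewrite addnAC]; exact: filtM.
have P1 t : P 0%N t t by split; rewrite ?subrr //; exact: filt_zero.
suff [] : P (mdeg m) (\prod_i u i ^+ m i) (\prod_i v i ^+ m i) by [].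
rewrite mdegE; elim/big_rec3: _ => // i t a b _; apply: (PM).
elim: (m i) => [//|e IH]; rewrite !exprS -add1n; apply: (PM) => //.
Qed.

Section Morphisms.
Variable f : {lrmorphism A -> A}.

Lemma lrmorph_mon m : f (mon m) = \prod_i f (var i) ^+ m i.
Proof. by rewrite monE rmorph_prod; apply: eq_bigr => i _; rewrite rmorphXn. Qed.

Hypothesis f1 : forall i, filt 1 (f (var i)).

Lemma lrmorph_filt r a : filt r a -> filt r (f a).
Proof.
move=> /filt_expand ->; rewrite linear_sum; apply: filt_sum => m rm.
rewrite linearZ /=; apply/filtZ/(filtW rm); rewrite lrmorph_mon.
rewrite mdegE; elim/big_rec2: _ => // i b t _ Fb; apply: filtM => //.
exact: filtX1.
Qed.

Lemma lrmorph_filtB r : (forall i, filt r.+1 (f (var i) - var i)) ->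
  forall s a, filt s a -> filt (s + r) (f a - a).
Proof.
move=> Fr s a /filt_expand ->; rewrite linear_sum -sumrB.
apply: filt_sum => m sm; rewrite linearZ -scalerBr /=; apply: filtZ.
apply: (@filtW _ (mdeg m + r)); first by rewrite leq_add2r.
rewrite lrmorph_mon monE; apply: filt_prodB => // i; exact: filt_var.
Qed.

(** An endomorphism that is the identity modulo order 2 is the identity minus a
    nilpotent operator, so it is inverted by a finite geometric series. *)
Lemma lrmorph_unip_bij : (forall i, filt 2 (f (var i) - var i)) -> bijective f.
Proof.
move=> /lrmorph_filtB Fr.
have Ff s a : filt s a -> filt s.+1 (a - f a).
  by move=> /Fr; rewrite addn1 -opprB => /filtN; rewrite opprK.
(* f is the identity minus nu, and nu raises the order by one. *)
pose nu a := a - f a.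
have nuN e a : filt e (iter e nu a) by elim: e => // e IH; exact: Ff.
have f_inj : injective f.
  move=> a b fab; apply/eqP; rewrite -subr_eq0; apply/eqP.
  have nuab : nu (a - b) = a - b by rewrite /nu linearB /= fab subrr subr0.
  have := nuN d.+3 (a - b).
  have -> : iter d.+3 nu (a - b) = a - b by elim: (d.+3) => //= e ->.
  by apply: filt_eq0.
(* The geometric series of nu, which stops since order d + 3 is zero. *)
pose g a := \sum_(e < d.+3) iter e nu a.
have gK : cancel g f.
  move=> a; have nu_sum : nu (g a) = \sum_(e < d.+3) iter e.+1 nu a.
    by rewrite /nu /g linear_sum -sumrB.
  have -> : f (g a) = g a - nu (g a) by rewrite /nu opprB addrC subrK.
  rewrite nu_sum /g -opprB -sumrB.
  rewrite -(big_mkord xpredT (fun e => iter e.+1 nu a - iter e nu a)).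
  rewrite telescope_sumr // (filt_eq0 (ltnSn _) (nuN _ _)).
  by rewrite sub0r opprK.
exists g => // a; exact: f_inj.
Qed.

End Morphisms.

End SocleAlgebra.

(** * Powers of linear forms and construction of automorphisms *)

Section LinearForms.
Variables (K : comNzRingType) (n : nat) (L : 'I_n -> K).
Local Notation ell := (\sum_j L j *: 'X_j : {mpoly K[n]}).

Lemma mcoeffMXU (p : {mpoly K[n]}) j m :
  (p * 'X_j)@_m = if (0 < m j)%N then p@_(m - U_(j)) else 0.
Proof.
case: ifP => [mj|mj].
  have mE : m = (U_(j) + (m - U_(j)))%MM.
    apply/mnmP => i; rewrite mnmDE mnmBE mnm1E; case: eqP => [<-|_] //.
      by rewrite subnKC.
    by rewrite subn0.
  by rewrite [in LHS]mE mcoeffMX.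
apply/eqP; rewrite mcoeff_eq0; apply/negP; rewrite (perm_mem (msuppMX _ _)).
by case/mapP => m' _ E; move: mj; rewrite E mnmDE mnm1E eqxx.
Qed.

(** The multinomial formula restricted to the monomials in two variables,
    proved by Pascal's rule. *)
Lemma mcoeff_linear_pow a b e f : a != b ->
  (ell ^+ (e + f))@_(U_(a) *+ e + U_(b) *+ f)%MM
    = 'C(e + f, e)%:R * (L a ^+ e * L b ^+ f).
Proof.
move=> ab; set M := fun e f => (U_(a) *+ e + U_(b) *+ f)%MM; rewrite -/(M e f).
have Ma x y : M x y a = x.
  by rewrite mnmDE !mulmnE !mnm1E eqxx (eq_sym b) (negPf ab) mul1n mul0n addn0.
have Mb x y : M x y b = y.
  by rewrite mnmDE !mulmnE !mnm1E eqxx (negPf ab) mul1n mul0n.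
have Mj j x y : j != a -> j != b -> M x y j = 0%N.
  by move=> ja jb; rewrite mnmDE !mulmnE !mnm1E !(eq_sym _ j) (negPf ja) (negPf jb).
have MBa x y : (M x.+1 y - U_(a))%MM = M x y.
  apply/mnmP => i; rewrite mnmBE !mnmDE !mulmnE !mnm1E; case: eqP => _ /=; lia.
have MBb x y : (M x y.+1 - U_(b))%MM = M x y.
  apply/mnmP => i; rewrite mnmBE !mnmDE !mulmnE !mnm1E; case: (b =P i) => _ /=; lia.
have [D DE] : exists D, D = (e + f)%N by exists (e + f)%N.
rewrite -DE; elim: D e f DE => [|D IH] e f DE.
  have [-> ->] : e = 0%N /\ f = 0%N by lia.
  by rewrite /M !mulm0n addm0 mcoeff1 eqxx !mulr1.
rewrite exprSr; set q := (ell ^+ D) in IH *; rewrite mulr_sumr raddf_sum.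
rewrite (bigD1 a) //= (bigD1 b) 1?eq_sym //=.
rewrite big1 ?addr0; last first.
  move=> j /andP[ja jb]; rewrite -scalerAr mcoeffZ mcoeffMXU Mj //.
  by rewrite mulr0.
rewrite -!scalerAr !mcoeffZ !mcoeffMXU Ma Mb.
case: e f DE => [|e] [|f] //= DE.
- rewrite mulr0 add0r MBb IH; last by lia.
  by rewrite !bin0 !mul1r exprS.
- rewrite mulr0 addr0 MBa IH; last by lia.
  have -> : e = D by lia.
  by rewrite !binn !mul1r !mulr1 exprS.
rewrite MBa MBb !IH; try lia.
rewrite binS natrD !exprS.
by ring.
Qed.
End LinearForms.

Section Automorphisms.
Variables (k : closedFieldType) (n d : nat) (B : pred 'X_{1..n}).
Local Notation R := {mpoly k[n]}.
Local Notation A := (socle_alg k d B).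
Local Notation standard := (standard d B).
Local Notation var := (@var k n d B).
Local Notation mon := (@mon k n d B).
Local Notation filt := (@filt k n d B).
Implicit Types (m : 'X_{1..n}) (a b : A).

Lemma lrmorph_ext (f g : {lrmorphism A -> A}) :
  (forall i, f (var i) = g (var i)) -> f =1 g.
Proof.
move=> fg a; rewrite [a]alg_expand !linear_sum; apply: eq_bigr => m _.
rewrite !linearZ /= !lrmorph_mon; congr (_ *: _).
by apply: eq_bigr => i _; rewrite fg.
Qed.

Lemma lrmorph_exists (y : 'I_n -> A) :
    (forall m, ~~ standard m -> \prod_i y i ^+ m i = 0) ->
  exists f : {lrmorphism A -> A}, forall i, f (var i) = y i.
Proof.
move=> y0.
(* Substitution kills the ideal, hence factors through representatives. *)
pose ev : R -> A := mmap (in_alg A) y.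
have ev0 p : proj d B p = 0 -> ev p = 0.
  move=> /eqP/proj_eq0 p0; rewrite /ev /mmap big_seq big1 // => m.
  rewrite mcoeff_msupp => pm; rewrite [mmap1 _ _]y0 ?mulr0 //.
  by apply: contra pm => /p0 ->.
pose f (a : A) := ev (rpoly a).
have fE p : f (proj d B p) = ev p.
  apply/eqP; rewrite -subr_eq0 -rmorphB; apply/eqP/ev0.
  by rewrite rmorphB /= rpolyK subrr.
have fL : linear f.
  move=> c u v; rewrite -[u]rpolyK -[v]rpolyK -linearP !fE.
  by rewrite /ev mmapD mmapZ /= mulr_algl.
have fM : GRing.monoid_morphism f.
  split=> [|u v]; first by rewrite -(rmorph1 (proj d B)) fE /ev !rmorph1.
  by rewrite -[u]rpolyK -[v]rpolyK -rmorphM !fE -rmorphM.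
pose F : {lrmorphism A -> A} := HB.pack f
  (GRing.isLinear.Build k A A *:%R f fL) (GRing.isMonoidMorphism.Build A A f fM).
by exists F => i; rewrite /= [LHS]fE /ev mmapX mmap1U.
Qed.

Lemma filt_prod_lead m s (c : 'I_n -> k) (y : 'I_n -> A) :
    (forall i, filt 2 (y i - c i *: var (s i))) ->
  filt (mdeg m).+1 (\prod_i y i ^+ m i -
    (\prod_i c i ^+ m i) *: \prod_i var (s i) ^+ m i).
Proof.
move=> y2; rewrite -scaler_prod.
have -> : \prod_i (c i ^+ m i *: var (s i) ^+ m i)
        = \prod_i (c i *: var (s i)) ^+ m i.
  by apply: eq_bigr => i _; rewrite exprZn.
rewrite -addn1; apply: filt_prodB => // i; last exact/filtZ/filt_var.
rewrite -[y i](subrK (c i *: var (s i))); apply: filtD; last exact/filtZ/filt_var.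
exact: filtW (y2 i).
Qed.

(** Monomials of the ideal have degree at least d + 2, and the ideal contains
    everything of larger degree; so only the leading term of the image of such a
    monomial matters, and it is a multiple of the same monomial. *)
Lemma lrmorph_diag_exists (c : 'I_n -> k) (y : 'I_n -> A) :
    (forall i, filt 2 (y i - c i *: var i)) ->
  exists f : {lrmorphism A -> A}, forall i, f (var i) = y i.
Proof.
move=> y2; apply: lrmorph_exists => m ms.
have dm : (d.+2 < (mdeg m).+1)%N.
  by rewrite ltnS leqNgt; apply: contra ms; exact: standard_lt.
have := filt_eq0 dm (@filt_prod_lead m id c y y2).
move/eqP; rewrite subr_eq0 => /eqP ->; rewrite -monE.
by move: ms; rewrite -(mon_eq0 k) => /eqP ->; rewrite scaler0.
Qed.

(** Such a substitution is a diagonal automorphism followed by one that is the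
    identity modulo order 2. *)
Lemma alg_aut_triangular (c : 'I_n -> k) (y : 'I_n -> A) :
    (forall i, c i != 0) -> (forall i, filt 2 (y i - c i *: var i)) ->
  exists phi : alg_aut A, forall i, phi (var i) = y i.
Proof.
move=> c0 y2; have [f fy] := lrmorph_diag_exists y2.
have z2 (e : 'I_n -> k) i : filt 2 (e i *: var i - e i *: var i).
  by rewrite subrr; exact: filt_zero.
have [D De] := lrmorph_diag_exists (z2 c).
have [D' De'] := lrmorph_diag_exists (z2 (fun i => (c i)^-1)).
have u2 i : filt 2 ((c i)^-1 *: y i - 1 *: var i).
  by rewrite -(mulVf (c0 i)) -scalerA -scalerBr; apply: filtZ.
have [u ue] := lrmorph_diag_exists u2.
have uB : bijective u.
  apply: lrmorph_unip_bij => i; rewrite ue; last first.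
    by have := u2 i; rewrite scale1r.
  apply: filtZ; rewrite -[y i](subrK (c i *: var i)).
  by apply: filtD; [exact: filtW (y2 i)|exact/filtZ/filt_var].
have DB : bijective D.
  exists D' => a.
    have := @lrmorph_ext (D' \o D) idfun _ a; apply => i.
    by rewrite /= De linearZ /= De' scalerA mulfV // scale1r.
  have := @lrmorph_ext (D \o D') idfun _ a; apply => i.
  by rewrite /= De' linearZ /= De scalerA mulVf // scale1r.
have fE : f =1 u \o D.
  apply: lrmorph_ext => i.
  by rewrite /= fy De linearZ /= ue scalerA mulfV // scale1r.
have [phi phiE] := bij_alg_aut (eq_bij (bij_comp uB DB) (fsym fE)).
by exists phi => i; rewrite phiE.
Qed.

Lemma alg_aut_perm (s t : 'I_n -> 'I_n) :
    cancel s t -> cancel t s ->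
    (forall m, standard [multinom m (t i) | i < n] = standard m) ->
  exists phi : alg_aut A, forall i, phi (var i) = var (s i).
Proof.
move=> sK tK ts.
have H (s' t' : 'I_n -> 'I_n) : cancel s' t' -> cancel t' s' ->
    (forall m, standard [multinom m (t' i) | i < n] = standard m) ->
    exists f : {lrmorphism A -> A}, forall i, f (var i) = var (s' i).
  move=> s'K t'K st'; apply: lrmorph_exists => m ms.
  rewrite (reindex t') /=; last by exists s' => i _.
  have -> : \prod_i var (s' (t' i)) ^+ m (t' i) = mon [multinom m (t' i) | i < n].
    by rewrite monE; apply: eq_bigr => i _; rewrite t'K mnmE.
  by apply/eqP; rewrite mon_eq0 st'.
have [f fe] := H s t sK tK ts.
have [|g ge] := H t s tK sK.
  move=> m; rewrite -ts; congr (standard _); apply/mnmP => i.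
  by rewrite !mnmE tK.
have fB : bijective f.
  exists g => a.
    have := @lrmorph_ext (g \o f) idfun _ a; apply => i.
    by rewrite /= fe ge sK.
  have := @lrmorph_ext (f \o g) idfun _ a; apply => i.
  by rewrite /= ge fe tK.
by have [phi phiE] := bij_alg_aut fB; exists phi => i; rewrite phiE.
Qed.

End Automorphisms.

(** * Split extensions of groups *)

Section SplitExtension.
Local Open Scope group_scope.
Variables (G H : groupType) (N : normal_subgroup G).
Variables (gam : G -> H) (sec : H -> G).
Hypothesis gamM : {morph gam : x y / x * y}.
Hypothesis secM : {morph sec : x y / x * y}.
Hypothesis secK : cancel sec gam.
Hypothesis kerN : forall x, nsub_set N x <-> gam x = 1.

Let gam1 : gam 1 = 1.
Proof. by apply: (@mulgI _ (gam 1)); rewrite -gamM !mulg1. Qed.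
Let gamV x : gam x^-1 = (gam x)^-1.
Proof. by apply: (@mulgI _ (gam x)); rewrite -gamM !mulgV. Qed.
Let sec1 : sec 1 = 1.
Proof. by apply: (@mulgI _ (sec 1)); rewrite -secM !mulg1. Qed.

Lemma quotient_split : isomorphic (quotient_group N) H.
Proof.
have eqpi x y : (\pi_(quotient_group N)%qT x = \pi_(quotient_group N)%qT y) <->
    gam x = gam y.
  have E : gam (x^-1 * y) = 1 <-> gam x = gam y.
    rewrite gamM gamV; split=> [E|->]; last exact: mulVg.
    by apply: (@mulgI _ (gam x)^-1); rewrite mulVg E.
  rewrite -E -kerN; split=> [/eqP|Nxy].
    by rewrite eqmodE /= /coset_equiv inE.
  by apply/eqP; rewrite eqmodE /= /coset_equiv inE.
have gr x : gam (repr (\pi_(quotient_group N)%qT x)) = gam x.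
  by apply/eqpi; rewrite reprK.
exists (fun u => gam (repr u)); split=> [u v|].
  have -> : u * v = \pi_(quotient_group N)%qT (repr u * repr v) by [].
  by rewrite gr gamM.
exists (fun h => \pi_(quotient_group N)%qT (sec h)) => [u|h].
  by rewrite -[RHS]reprK; apply/eqpi; rewrite secK.
by rewrite gr secK.
Qed.

Lemma semidirect_split :
  exists (theta : group_action H (subg_type N)) (f : semidirect theta -> G),
    group_iso f /\ (forall x : subg_type N, f (x, 1) = val x).
Proof.
have conjN h (x : subg_type N) : (sec h * val x * (sec h)^-1) \in nsub_set N.
  have := valP x; rewrite !inE => Nx; have := nsub_conj (sec h)^-1 Nx.
  by rewrite conjgE invgK mulgA.
pose act h (x : subg_type N) : subg_type N :=
  exist (fun y => y \in nsub_set N) _ (conjN h x).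
have act1 x : act 1 x = x.
  by apply: val_inj; rewrite /= sec1 mul1g invg1 mulg1.
have actM a b x : act (a * b) x = act a (act b x).
  by apply: val_inj; rewrite /= secM invgM !mulgA.
have act_morph a x y : act a (x * y) = act a x * act a y.
  by apply: val_inj; rewrite /= !mulgA mulgKV.
pose theta := GroupAction act1 actM act_morph.
exists theta, (fun u => val u.1 * sec u.2); split; last first.
  by move=> x; rewrite sec1 mulg1.
split=> [[x a] [y b]|].
  by rewrite /= secM !mulgA mulgKV.
have gN x : x * (sec (gam x))^-1 \in nsub_set N.
  by rewrite inE kerN gamM gamV secK mulgV.
exists (fun x => (exist (fun y => y \in nsub_set N) _ (gN x), gam x))
  => [[x a]|x] /=; last exact: mulgKV.
have ga : gam (val x * sec a) = a.
  by rewrite gamM secK; have := valP x; rewrite inE => /kerN ->; rewrite mul1g.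
congr (_, _); last exact: ga.
by apply: val_inj; rewrite /= ga mulgK.
Qed.
End SplitExtension.

(** * Leading terms of automorphisms *)

Section AutStructure.
Variables (k : closedFieldType) (n d : nat) (B : pred 'X_{1..n}).
Local Notation R := {mpoly k[n]}.
Local Notation A := (socle_alg k d B).
Local Notation standard := (standard d B).
Local Notation var := (@var k n d B).
Local Notation mon := (@mon k n d B).
Local Notation filt := (@filt k n d B).
Implicit Types (m : 'X_{1..n}) (a b : A) (phi psi : alg_aut A).

Lemma alg_autM phi psi a : (phi * psi)%g a = phi (psi a). Proof. by []. Qed.
Lemma alg_aut1 a : (1%g : alg_aut A) a = a. Proof. by []. Qed.
Lemma alg_autK phi : cancel phi (phi^-1)%g.
Proof. by move=> a; rewrite -alg_autM mulVg. Qed.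
Lemma alg_autVK phi : cancel (phi^-1)%g phi.
Proof. by move=> a; rewrite -alg_autM mulgV. Qed.

Lemma alg_aut_var_ext phi psi : (forall i, phi (var i) = psi (var i)) -> phi = psi.
Proof.
move=> H; apply: alg_aut_ext.
exact: (@lrmorph_ext _ _ _ _ (aut_val phi) (aut_val psi)).
Qed.

Lemma standard0 : standard 0%MM.
Proof. by apply: standard_lt; rewrite mdeg0. Qed.
Lemma standardU i : standard U_(i)%MM.
Proof. by apply: standard_lt; rewrite mdeg1. Qed.

Lemma mcoord0X a e : mcoord 0%MM (a ^+ e) = mcoord 0%MM a ^+ e.
Proof.
by rewrite -{1}[a]rpolyK -rmorphXn mcoord_proj ?standard0 //; exact: (rmorphXn (mcoeff 0%MM)).
Qed.

Lemma mcoord_var i j : mcoord U_(j)%MM (var i) = (i == j)%:R.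
Proof. by rewrite mcoord_proj ?standardU // mcoeffXU. Qed.

(** The variables are nilpotent, so their images have no constant term. *)
Lemma alg_aut_filt1 phi i : filt 1 (phi (var i)).
Proof.
have x0 : var i ^+ d.+3 = 0.
  exact: (filt_eq0 (ltnSn _) (filtX1 (e := d.+3) (@filt_var k n d B i))).
have c0 : mcoord 0%MM (phi (var i)) = 0.
  apply/eqP; have : mcoord 0%MM (phi (var i)) ^+ d.+3 == 0.
    rewrite -mcoord0X -rmorphXn x0 rmorph0; apply/eqP.
    by apply: (@filt_zero k n d B 1%N); rewrite ?mdeg0 //; exact: standard0.
  by rewrite expf_eq0.
by move=> m ms; rewrite ltnS leqn0 mdeg_eq0 => /eqP ->.
Qed.

Lemma alg_aut_filt phi r a : filt r a -> filt r (phi a).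
Proof. apply: (@lrmorph_filt _ _ _ _ (aut_val phi)); exact: alg_aut_filt1. Qed.

Lemma alg_aut_filtE phi r a : filt r (phi a) -> filt r a.
Proof. by move=> /(alg_aut_filt (phi^-1)%g); rewrite alg_autK. Qed.

(** Each column of the linear part of [phi] has exactly one nonzero entry. *)
Definition leading phi (s : 'I_n -> 'I_n) (c : 'I_n -> k) :=
  forall i, c i != 0 /\ filt 2 (phi (var i) - c i *: var (s i)).

(** Otherwise the image of the variable would have order 2, and applying the
    inverse automorphism so would the variable. *)
Lemma alg_aut_lead_coef phi i : exists j, mcoord U_(j)%MM (phi (var i)) != 0.
Proof.
apply: contrapT => /forallNP H.
have /alg_aut_filtE F2 : filt 2 (phi (var i)).
  move=> m ms; rewrite ltnS leq_eqVlt => /predU1P[/eqP/mdeg1P[j /eqP ->]|m1].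
    by apply/eqP/negPn/negP; exact: H.
  exact: alg_aut_filt1.
have := F2 _ (standardU i); rewrite mdeg1 mcoord_var eqxx => /(_ isT)/eqP.
by rewrite oner_eq0.
Qed.

Lemma leading_mon phi s c m : leading phi s c -> mdeg m = d.+2 ->
  phi (mon m) = (\prod_i c i ^+ m i) *: \prod_i var (s i) ^+ m i.
Proof.
move=> lead md; apply/eqP; rewrite -subr_eq0 (lrmorph_mon (aut_val phi)).
apply/eqP/(@filt_eq0 _ _ _ _ (mdeg m).+1); first by rewrite md.
by apply: filt_prod_lead => i; have [] := lead i.
Qed.

Lemma leading_top phi s c m : leading phi s c -> mdeg m = d.+2 -> B m ->
  \prod_i var (s i) ^+ m i != 0.
Proof.
move=> lead md Bm; have : mon m != 0.
  by rewrite mon_eq0 negbK /standard md eqxx Bm orbT.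
apply: contraNneq => s0; rewrite -[mon m](alg_autK phi).
by rewrite (leading_mon lead md) s0 scaler0 linear0.
Qed.

Lemma leading_coef phi s c i j : leading phi s c ->
  mcoord U_(j)%MM (phi (var i)) = c i * (s i == j)%:R.
Proof.
move=> /(_ i)[_ F]; have sj := standardU j.
rewrite -[phi _](subrK (c i *: var (s i))) mcoordD // F ?mdeg1 // add0r.
by rewrite mcoordZ // mcoord_var.
Qed.

Lemma leading_uniq phi s s' c c' : leading phi s c -> leading phi s' c' -> s =1 s'.
Proof.
move=> l l' i; have [c0 _] := l i; apply/eqP; rewrite eq_sym.
have := leading_coef i (s i) l; rewrite (leading_coef i (s i) l') eqxx mulr1.
by case: (s' i == s i) => // E; move: c0; rewrite -E mulr0 eqxx.
Qed.

Lemma leading_mul phi psi s t c e : leading phi s c -> leading psi t e ->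
  leading (phi * psi)%g (s \o t) (fun i => e i * c (t i)).
Proof.
move=> lphi lpsi i; have [e0 Fpsi] := lpsi i; have [c0 Fphi] := lphi (t i).
split; first by rewrite mulf_neq0.
rewrite /= -[psi _](subrK (e i *: var (t i))).
move: (_ - _) Fpsi => w Fw; rewrite linearD linearZ /= -scalerA -addrA -scalerBr.
by apply: filtD; [exact: alg_aut_filt|exact: filtZ].
Qed.

Section Rigid.
Hypothesis char0 : [pchar k] =i pred0.
Hypothesis B_pure : forall i, ~~ B (U_(i) *+ d.+2)%MM.
Hypothesis B_pair : forall i j, i != j ->
  exists e f, (e + f)%N = d.+2 /\ B (U_(i) *+ e + U_(j) *+ f)%MM.

(** The image of the variable and its linear part [ell] have the same power of
    exponent d + 2, which vanishes as the pure power of the variable does.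
    The coefficient of [ell ^+ d.+2] at the surviving monomial in the variables
    [a] and [b] is a nonzero multiple of a product of powers of the two linear
    coefficients. *)
Lemma alg_aut_coef_pair phi i (a b : 'I_n) : a != b ->
  mcoord U_(a)%MM (phi (var i)) * mcoord U_(b)%MM (phi (var i)) = 0.
Proof.
move=> ab; pose L j := mcoord U_(j)%MM (phi (var i)).
pose ell := \sum_j L j *: 'X_j : R.
have ell_i : filt 2 (phi (var i) - proj d B ell).
  move=> m ms; rewrite ltnS leq_eqVlt => /predU1P[/eqP/mdeg1P[j /eqP ->]|].
    rewrite -[phi _]rpolyK -rmorphB mcoord_proj ?standardU // mcoeffB.
    rewrite raddf_sum (bigD1 j) //= big1 ?addr0.
      by rewrite mcoeffZ mcoeffXU eqxx mulr1 subrr.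
    by move=> j' jj'; rewrite mcoeffZ mcoeffXU (negPf jj') mulr0.
  move=> m0; suff: filt 1 (phi (var i) - proj d B ell) by exact.
  apply: filtB; first exact: alg_aut_filt1.
  rewrite linear_sum; apply: filt_sum => j _; rewrite linearZ /=.
  exact/filtZ/filt_var.
have p0 : proj d B (ell ^+ d.+2) = 0.
  have x0 : var i ^+ d.+2 = 0.
    rewrite -rmorphXn /= mpolyXn; apply/eqP; rewrite mon_eq0 /standard.
    by rewrite mdegMn mdeg1 mul1n ltnn eqxx /=; exact: B_pure.
  have : filt (2 + d.+1) (phi (var i) ^+ d.+2 - proj d B ell ^+ d.+2).
    rewrite subrXX; apply: filtM => //; apply: filt_sum => -[e ed] _ /=.
    rewrite -[X in filt X](subnK (ed : (e <= d.+1)%N)).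
    apply: filtM; apply: filtX1; first exact: alg_aut_filt1.
    rewrite -[proj _ _ _](subKr (phi (var i))).
    by apply: filtB; [exact: alg_aut_filt1|exact: filtW ell_i].
  move=> /filt_eq0 -/(_ (ltnSn _)) /eqP.
  by rewrite -rmorphXn x0 rmorph0 sub0r oppr_eq0 -rmorphXn => /eqP.
have [e [f [ef Bef]]] := B_pair ab.
have sef : standard (U_(a) *+ e + U_(b) *+ f)%MM.
  by rewrite /standard mdegD !mdegMn !mdeg1 !mul1n ef eqxx Bef orbT.
have := mcoord_proj (ell ^+ d.+2) sef; rewrite p0 -ef mcoeff_linear_pow //.
rewrite (@filt_zero _ _ _ _ (d.+3)) //; last first.
  by rewrite mdegD !mdegMn !mdeg1 !mul1n ef.
move/esym/eqP; rewrite mulf_eq0 (pcharf0P k).1 // eqn0Ngt bin_gt0 leq_addr /=.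
rewrite mulf_eq0 !expf_eq0 => /orP[] /andP[_ /eqP E]; first by rewrite -/(L a) E mul0r.
by rewrite -/(L b) E mulr0.
Qed.

Lemma alg_aut_leading phi : exists s c, leading phi s c.
Proof.
have [s s0] := choice (alg_aut_lead_coef phi).
exists s, (fun i => mcoord U_(s i)%MM (phi (var i))) => i; split=> // m ms.
rewrite ltnS leq_eqVlt => /predU1P[/eqP/mdeg1P[j /eqP ->]|m1].
  rewrite mcoordD ?standardU // -scaleNr mcoordZ ?standardU // mcoord_var.
  have [<-|sj] := eqVneq (s i) j; first by rewrite mulr1 subrr.
  rewrite mulr0 addr0; have /eqP := alg_aut_coef_pair phi i sj.
  by rewrite mulf_eq0 (negPf (s0 i)) => /eqP.
suff: filt 1 (phi (var i) - mcoord U_(s i)%MM (phi (var i)) *: var (s i)) by exact.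
by apply: filtB; [exact: alg_aut_filt1|exact/filtZ/filt_var].
Qed.

End Rigid.
End AutStructure.

(** * Triangular automorphisms: connectedness and solvability *)

Section Triangular.
Variables (k : closedFieldType) (n d : nat) (B : pred 'X_{1..n}).
Local Notation A := (socle_alg k d B).
Local Notation standard := (standard d B).
Local Notation var := (@var k n d B).
Local Notation mon := (@mon k n d B).
Local Notation filt := (@filt k n d B).
Implicit Types (m : 'X_{1..n}) (a b : A) (phi psi : alg_aut A).

Section Segment.
Variable phi : alg_aut A.
(** The affine line through the identity ([s = 0]) and [phi] ([s = 1]). *)
Definition on_segment s psi :=
  forall i, psi (var i) = var i + s *: (phi (var i) - var i).

Lemma segment_value a :
  exists Q : {poly A}, forall s psi, on_segment s psi -> psi a = Q.[s%:A].
Proof.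
exists (\sum_(m <- msupp (rpoly a) | standard m) (mcoord m a)%:A%:P *
  \prod_i ((var i)%:P + (phi (var i) - var i)%:P * 'X) ^+ m i).
move=> s psi on_s; rewrite {1}[a]alg_expand linear_sum horner_sum.
apply: eq_bigr => m _; rewrite linearZ /= hornerM hornerC mulr_algl.
congr (_ *: _); rewrite (lrmorph_mon (aut_val psi)) horner_prod.
apply: eq_bigr => i _; rewrite horner_exp hornerD hornerM !hornerC hornerX.
by rewrite /= on_s mulr_algr.
Qed.

(** Along the line, regular functions are polynomials in the parameter. *)
Lemma segment_regular p : regular_fun p ->
  exists P : {poly k}, forall s psi, on_segment s psi -> p psi = P.[s].
Proof.
elim=> [c|l a|q r _ [Q QE] _ [S SE]|q r _ [Q QE] _ [S SE]].
- by exists c%:P => s psi _; rewrite hornerC.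
- have [Q QE] := segment_value a.
  exists (\poly_(i < size Q) l Q`_i) => s psi /QE ->.
  rewrite horner_poly horner_coef linear_sum; apply: eq_bigr => i _.
  by rewrite exprZn expr1n mulr_algr linearZ /= mulrC.
- by exists (Q + S) => s psi on_s; rewrite hornerD (QE _ _ on_s) (SE _ _ on_s).
- by exists (Q * S) => s psi on_s; rewrite hornerM (QE _ _ on_s) (SE _ _ on_s).
Qed.

(** On the line, all but finitely many parameters give automorphisms.  Two
    disjoint nonempty open pieces would give nonzero polynomials whose product
    vanishes at all those parameters, which is impossible over an infinite
    field. *)
Lemma triangular_connected c : leading phi id c -> aut0_set phi.
Proof.
move=> lead; pose C := [set psi | exists s, on_segment s psi]%classic.
(* The parameters at which the line leaves the group are the roots of D. *)
pose D := \prod_i (1 + (c i - 1)%:P * 'X : {poly k}).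
have D0 : D != 0.
  apply/prodf_neq0 => i _; apply: contraTneq isT => E.
  have := congr1 (fun p => p.[0]) E.
  by rewrite !hornerE ?mulr0 ?addr0 => /eqP; rewrite oner_eq0.
have on_C s : D.[s] != 0 -> exists psi, on_segment s psi.
  rewrite horner_prod => /prodf_neq0 Ds.
  apply: (@alg_aut_triangular _ _ _ _ (fun i => 1 + (c i - 1) * s)) => i.
    by have := Ds i isT; rewrite !hornerE.
  have -> : var i + s *: (phi (var i) - var i) - (1 + (c i - 1) * s) *: var i
      = s *: (phi (var i) - c i *: var i).
    rewrite scalerDl scale1r [(c i - 1) * s]mulrC -scalerA scalerBl scale1r.
    by rewrite opprD addrACA subrr add0r -scalerBr opprB addrA subrK.
  by apply: filtZ; case: (lead i).
have Cc : connected C.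
  move=> U [f Uf] [O oO UO] [F cF UF]; apply: contrapT => UC.
  have [g [Cg nUg]] : exists g, C g /\ ~ U g.
    apply: contrapT => H; apply: UC; apply/seteqP; split=> g.
      by rewrite UO => -[].
    by move=> Cg; apply: contrapT => Ug; apply: H; exists g.
  have [Cf Of] : C f /\ O f by move: Uf; rewrite UO.
  have nFg : ~ F g by move=> Fg; apply: nUg; rewrite UF.
  have oF : open (~` F)%classic by rewrite openC.
  rewrite zariski_openE in oO oF.
  have [p [rp pf pO]] := (zariski_openP _).1 oO _ Of.
  have [q [rq qg qF]] := (zariski_openP _).1 oF _ nFg.
  have [P PE] := segment_regular rp; have [Q QE] := segment_regular rq.
  have [sf on_f] := Cf; have [sg on_g] := Cg.
  have P0 : P != 0 by apply: contraNneq pf => E; rewrite (PE _ _ on_f) E horner0.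
  have Q0 : Q != 0 by apply: contraNneq qg => E; rewrite (QE _ _ on_g) E horner0.
  have /closed_nonrootP[s] : P * Q * D != 0 by rewrite !mulf_neq0.
  rewrite /root !hornerM !mulf_eq0 !negb_or => /andP[/andP[Ps Qs] Ds].
  have [psi on_s] := on_C _ Ds.
  have Cpsi : C psi by exists s.
  have Opsi : O psi by apply: pO; rewrite (PE _ _ on_s).
  have : U psi by rewrite UO.
  rewrite UF => -[_]; apply: qF; by rewrite (QE _ _ on_s).
have H : (C `<=` connected_component [set: alg_aut A] 1%g)%classic.
  apply: connected_component_max => //.
  by exists 0 => i; rewrite scale0r addr0.
apply: H; by exists 1 => i; rewrite scale1r addrC subrK.
Qed.

End Segment.

Section Solvable.
Local Open Scope group_scope.
Variable N : normal_subgroup (alg_aut A).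
Local Notation gN := (subg_type N).

Definition congruence r : set gN :=
  [set x : gN | forall i, filt r ((val x : alg_aut A) (var i) - var i)]%classic.

Lemma congruence_subgroup r : is_subgroup (congruence r).
Proof.
split=> [i|x y xr yr i]; first by rewrite val1 alg_aut1 subrr; exact: filt_zero.
rewrite valM gmulfV alg_autM.
set phi : alg_aut A := val x; set psi : alg_aut A := val y.
have F : filt r (phi ((psi^-1)%g (var i) - var i)).
  apply/alg_aut_filt/(alg_aut_filtE (phi := psi)).
  by rewrite linearB /= alg_autVK -opprB; apply/filtN/yr.
rewrite -[X in filt r X](subrK (phi (var i) - var i)); apply: filtD; last exact: xr.
by rewrite opprB addrA subrK -linearB.
Qed.

(** Since [phi * psi = psi * phi * [~ phi, psi]], applying [psi * phi] turns the
    displacement of the commutator into the failure of commutation, and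
    automorphisms preserve the filtration. *)
Lemma commutator_filt r (phi psi : alg_aut A) i :
  filt r (phi (psi (var i)) - psi (phi (var i))) ->
  filt r ([~ phi, psi] (var i) - var i).
Proof.
move=> F; apply: (alg_aut_filtE (phi := psi * phi)).
rewrite linearB /=.
have -> // : psi (phi ([~ phi, psi] (var i))) = phi (psi (var i)).
by rewrite -!alg_autM -commgC.
Qed.

(** With u and v the displacements of a variable under [psi] and [phi], the
    failure of commutation is the difference of the displacements of u and v,
    each of order at least r + (r - 1). *)
Lemma congruence_commg r x y : (1 < r)%N ->
  congruence r x -> congruence r y -> congruence r.+1 [~ x, y].
Proof.
case: r => // r r0 xr yr i; rewrite gmulfR; apply: commutator_filt.
set phi : alg_aut A := val x; set psi : alg_aut A := val y; set a := var i.
have -> : phi (psi a) - psi (phi a) =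
   (phi (psi a - a) - (psi a - a)) - (psi (phi a - a) - (phi a - a)).
  by rewrite !linearB /=; ring.
apply: (@filtW _ _ _ _ _ (r.+1 + r)%N); first by lia.
apply: filtB.
  exact: (lrmorph_filtB (f := aut_val phi) (@alg_aut_filt1 _ _ _ _ phi) xr (yr i)).
exact: (lrmorph_filtB (f := aut_val psi) (@alg_aut_filt1 _ _ _ _ psi) yr (xr i)).
Qed.

Hypothesis triangular : forall phi, nsub_set N phi -> exists c, leading phi id c.

(** The first step uses that the diagonal parts commute. *)
Lemma derived_congruence j : (@derived_series gN j.+1 `<=` congruence j.+2)%classic.
Proof.
have sub S r : (S `<=` congruence r -> Defs.generated S `<=` congruence r)%classic.
  by move=> SC; apply: smallest_sub => //; exact: congruence_subgroup.
elim: j => [|j IH]; apply: sub => _ [x xD [y yD <-]]; last first.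
  by apply: congruence_commg => //; exact: IH.
move=> i; rewrite gmulfR; apply: commutator_filt.
have tri (z : gN) : exists c, leading (val z : alg_aut A) id c.
  by apply: triangular; have := valP z; rewrite inE.
have [c lx] := tri x; have [e ly] := tri y.
have [_ Fxy] := leading_mul lx ly i; have [_ Fyx] := leading_mul ly lx i.
move: (filtB Fxy Fyx); rewrite !alg_autM /= [(c i * e i)%R]mulrC.
by rewrite opprB addrA subrK.
Qed.

Lemma solvable_triangular : solvable_group gN.
Proof.
exists d.+2; apply/seteqP; split=> [x /derived_congruence xC|_ ->].
  apply: val_inj; rewrite val1; apply: alg_aut_var_ext => i.
  by apply/eqP; rewrite alg_aut1 -subr_eq0; apply/eqP/(filt_eq0 _ (xC i)).
by move=> S [[S1 _] _].
Qed.
End Solvable.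
End Triangular.

(** * The Cayley monomials of a finite group *)

(** Exponents at most n cannot be confused with their complements to 2n + 2.
    The booleans, kept unsimplified in the products, compare the two variables
    of one monomial with the two variables at which both are evaluated. *)
Lemma exponents_match (n e w : nat) (ia ib ja jb : bool) :
    (0 < e <= n)%N -> (0 < w <= n)%N -> ~~ (ia && ib) -> ~~ (ja && jb) ->
    (ia * e + ja * (n.*2.+2 - e) = true * w + false * (n.*2.+2 - w))%N ->
    (ib * e + jb * (n.*2.+2 - e) = false * w + true * (n.*2.+2 - w))%N ->
  [/\ ia, jb & e = w].
Proof.
by case: ia; case: ib => //; case: ja; case: jb => //= en wn _ _ Ea Eb;
  (split=> //; lia) || (exfalso; lia).
Qed.

Section Cayley.
Local Open Scope nat_scope.
Variable gT : finGroupType.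
Local Notation n := #|gT|.
Local Notation deg := (n.*2.+2).

Definition translate (g : gT) (i : 'I_n) : 'I_n := enum_rank (g * enum_val i)%g.
(** The index of the group element taking i to j by right multiplication: the
    colour of the edge (i, j) of the Cayley graph, shifted by one so that it is a
    positive exponent. *)
Definition colour (i j : 'I_n) : nat := (enum_rank ((enum_val i)^-1 * enum_val j)%g).+1.
Definition two_var (i j : 'I_n) e f : 'X_{1..n} := (U_(i) *+ e + U_(j) *+ f)%MM.
Definition cayley_mon i j := two_var i j (colour i j) (deg - colour i j).
Definition cayley : pred 'X_{1..n} :=
  fun m => [exists i, exists j, (i != j) && (m == cayley_mon i j)].

Lemma cayleyP m : reflect (exists i j, i != j /\ m = cayley_mon i j) (cayley m).
Proof.
apply: (iffP existsP) => [[i /existsP[j /andP[ij /eqP->]]]|[i [j [ij ->]]]].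
  by exists i, j.
by exists i; apply/existsP; exists j; rewrite ij eqxx.
Qed.

Lemma two_varE i j e f l : two_var i j e f l = (i == l) * e + (j == l) * f.
Proof. by rewrite mnmDE !mulmnE !mnm1E. Qed.

Lemma mdeg_two_var i j e f : mdeg (two_var i j e f) = e + f.
Proof. by rewrite mdegD !mdegMn !mdeg1 !mul1n. Qed.

Lemma colour_bound i j : 0 < colour i j <= n.
Proof. by rewrite /colour ltn_ord. Qed.

Lemma mdeg_cayley_mon i j : mdeg (cayley_mon i j) = deg.
Proof. by rewrite mdeg_two_var; have := colour_bound i j; lia. Qed.

Lemma colour_inj i j i' j' : colour i j = colour i' j' ->
  ((enum_val i)^-1 * enum_val j = (enum_val i')^-1 * enum_val j')%g.
Proof. by move=> [] /val_inj/enum_rank_inj. Qed.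

(** The variable with the small exponent is the source of the edge, so a
    surviving monomial determines its colour; this also excludes i = j. *)
Lemma cayley_two_var i j e : 0 < e <= n -> cayley (two_var i j e (deg - e)) ->
  i != j /\ colour i j = e.
Proof.
move=> en /cayleyP[a [b [ab E]]]; have w := colour_bound a b.
have excl l : ~~ ((l == a) && (l == b)).
  by apply: contraNN ab => /andP[/eqP <- /eqP ->].
have Ea := congr1 (fun m : 'X_{1..n} => m a) E.
have Eb := congr1 (fun m : 'X_{1..n} => m b) E.
rewrite /= !two_varE !eqxx [b == a]eq_sym (negPf ab) in Ea Eb.
by have [/eqP -> /eqP -> <-] := exponents_match en w (excl i) (excl j) Ea Eb.
Qed.

Lemma cayley_pure i : ~~ cayley (U_(i) *+ deg)%MM.
Proof.
apply/cayleyP => -[a [b [ab E]]].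
have := congr1 (fun m : 'X_{1..n} => m a) E.
rewrite /= two_varE mulmnE mnm1E eqxx [b == a]eq_sym (negPf ab).
move: (colour a b) (colour_bound a b) => w; case: (i == a) => /=; lia.
Qed.

Lemma cayley_pair i j : i != j ->
  exists e f, (e + f = deg) /\ cayley (U_(i) *+ e + U_(j) *+ f)%MM.
Proof.
move=> ij; exists (colour i j), (deg - colour i j).
by split; [have := colour_bound i j; lia|apply/cayleyP; exists i, j].
Qed.

Lemma translate1 i : translate 1 i = i.
Proof. by rewrite /translate mul1g enum_valK. Qed.

Lemma translateM g h i : translate (g * h) i = translate g (translate h i).
Proof. by rewrite /translate enum_rankK mulgA. Qed.

Lemma translateK g : cancel (translate g) (translate g^-1).
Proof. by move=> i; rewrite -translateM mulVg translate1. Qed.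

Lemma translateVK g : cancel (translate g^-1) (translate g).
Proof. by move=> i; rewrite -translateM mulgV translate1. Qed.

Lemma colour_translate g i j : colour (translate g i) (translate g j) = colour i j.
Proof. by rewrite /colour /translate !enum_rankK invgM mulgA mulgKV. Qed.

Lemma cayley_translate g (m : 'X_{1..n}) :
  cayley m -> cayley [multinom m (translate g i) | i < n].
Proof.
case/cayleyP=> i [j [ij ->]]; apply/cayleyP.
exists (translate g^-1 i), (translate g^-1 j).
rewrite (inj_eq (can_inj (translateVK g))) ij; split=> //; apply/mnmP => l.
rewrite mnmE /cayley_mon colour_translate !two_varE.
by rewrite !(can2_eq (translateVK g) (translateK g)).
Qed.

Lemma standard_translate g (m : 'X_{1..n}) :
  standard n.*2 cayley [multinom m (translate g i) | i < n] = standard n.*2 cayley m.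
Proof.
have md h (m' : 'X_{1..n}) : mdeg [multinom m' (translate h i) | i < n] = mdeg m'.
  rewrite !mdegE [RHS](reindex (translate h)) /=.
    by apply: eq_bigr => i _; rewrite mnmE.
  by exists (translate h^-1) => i _; rewrite ?translateK ?translateVK.
rewrite /standard md; congr (_ || _ && _); apply/idP/idP; last exact: cayley_translate.
move=> /(cayley_translate g^-1); congr (cayley _); apply/mnmP => i.
by rewrite !mnmE translateVK.
Qed.

End Cayley.

(** * The automorphism group of the Cayley algebra *)

Section CayleyAut.
Variables (k : closedFieldType) (gT : finGroupType).
Hypothesis char0 : [pchar k] =i pred0.
Local Notation n := #|gT|.
Local Notation d := (n.*2).
Local Notation B := (@cayley gT).
Local Notation A := (socle_alg k d B).
Local Notation var := (@var k n d B).
Local Notation mon := (@mon k n d B).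
Implicit Types (phi psi : alg_aut A).

Definition root_var : 'I_n := enum_rank (1%g : gT).

Lemma translate_root g : enum_val (translate g root_var) = g.
Proof. by rewrite /translate !enum_rankK mulg1. Qed.

Lemma prod_two_var (S : comNzRingType) (y : 'I_n -> S) i j e f :
  \prod_l y l ^+ two_var i j e f l = y i ^+ e * y j ^+ f.
Proof.
have pU a x : \prod_l y l ^+ (U_(a) *+ x)%MM l = y a ^+ x.
  rewrite (bigD1 a) //= big1 ?mulr1; first by rewrite mulmnE mnm1E eqxx mul1n.
  by move=> l la; rewrite mulmnE mnm1E eq_sym (negPf la).
by rewrite -!pU -big_split; apply: eq_bigr => l _; rewrite mnmDE exprD.
Qed.

(** The image of the Cayley monomial of (i, j) is a nonzero multiple of the
    monomial with the same exponents in the variables s i and s j, which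
    therefore survives. *)
Lemma leading_colour phi s c i j : leading phi s c -> i != j ->
  colour (s i) (s j) = colour i j.
Proof.
move=> lead ij; have Bij : cayley (cayley_mon i j).
  by apply/cayleyP; exists i, j.
have := leading_top lead (mdeg_cayley_mon i j) Bij.
rewrite prod_two_var -(prod_two_var var) -monE mon_eq0 negbK.
have sdeg : mdeg (two_var (s i) (s j) (colour i j) (d.+2 - colour i j)) = d.+2.
  by rewrite mdeg_two_var -(mdeg_two_var i j); exact: mdeg_cayley_mon.
rewrite /standard sdeg ltnn eqxx /= => /(cayley_two_var (colour_bound i j)).
by case.
Qed.

(** A permutation that preserves i^-1 j is left multiplication by the image
    of 1. *)
Lemma alg_aut_translate phi : exists g c, leading phi (translate g) c.
Proof.
have [s [c lead]] := alg_aut_leading char0 (@cayley_pure gT) (@cayley_pair gT) phi.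
exists (enum_val (s root_var)), c => i.
suff <- : s i = translate (enum_val (s root_var)) i by exact: lead.
have [->|ri] := eqVneq i root_var.
  by rewrite /translate enum_rankK mulg1 enum_valK.
have /colour_inj := leading_colour lead ri; rewrite enum_rankK => E.
apply: enum_val_inj; rewrite enum_rankK.
apply: (@mulgI _ (enum_val (s i))^-1)%g.
by rewrite mulVg mulgA E mulg1 mulVg.
Qed.

(** The projection of the automorphism group onto the finite group. *)
Definition shift phi : gT := sval (cid (alg_aut_translate phi)).

Lemma shiftP phi : exists c, leading phi (translate (shift phi)) c.
Proof. by rewrite /shift; case: cid. Qed.

Lemma shift_eq phi g c : leading phi (translate g) c -> shift phi = g.
Proof.
move=> lead; have [c' lead'] := shiftP phi.
by rewrite -(translate_root g) -(leading_uniq lead' lead) translate_root.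
Qed.

Lemma shiftM : {morph shift : phi psi / (phi * psi)%g}.
Proof.
move=> phi psi; have [c lphi] := shiftP phi; have [e lpsi] := shiftP psi.
apply: shift_eq => i; have := leading_mul lphi lpsi i; rewrite /= translateM.
exact.
Qed.

Lemma translate_aut_ex g :
  exists phi : alg_aut A, forall i, phi (var i) = var (translate g i).
Proof.
apply: alg_aut_perm (translateK g) (translateVK g) _ => m.
exact: standard_translate.
Qed.

Definition translate_aut g : alg_aut A := sval (cid (translate_aut_ex g)).

Lemma translate_autE g i : translate_aut g (var i) = var (translate g i).
Proof. by rewrite /translate_aut; case: cid. Qed.

Lemma translate_autM : {morph translate_aut : g h / (g * h)%g}.
Proof.
move=> g h; apply: alg_aut_var_ext => i.
by rewrite alg_autM !translate_autE translateM.
Qed.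

Lemma translate_autK : cancel translate_aut shift.
Proof.
move=> g; apply: (@shift_eq _ _ (fun=> 1)) => i.
by rewrite translate_autE scale1r subrr oner_neq0; split=> //; exact: filt_zero.
Qed.

(** The linear part of the image of x_1 has a single nonzero coefficient, whose
    position is the group element; so each fibre of [shift] is given by the
    non-vanishing of one regular function. *)
Lemma shift_mcoord phi g : shift phi = g <->
  mcoord U_(translate g root_var)%MM (phi (var root_var)) != 0.
Proof.
have [c lead] := shiftP phi; have [c0 _] := lead root_var.
rewrite (leading_coef _ _ lead) mulf_eq0 negb_or c0 /=.
split=> [->|]; first by rewrite eqxx oner_neq0.
have [E _|_] := eqVneq (translate (shift phi) root_var) (translate g root_var);
  last by rewrite eqxx.
by rewrite -(translate_root g) -E translate_root.
Qed.

Lemma open_shift (P : gT -> Prop) : open [set phi | P (shift phi)]%classic.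
Proof.
rewrite zariski_openE; apply/zariski_openP => phi Pphi.
exists (fun psi => mcoord_form k
  (standardU d B (translate (shift phi) root_var)) (psi (var root_var))).
split=> [||psi /shift_mcoord /= ->//]; first exact: RegularEntry.
exact/shift_mcoord.
Qed.

(** The kernel of [shift] is open and closed, so it contains the component of
    the identity; its elements are triangular, so they lie in that component. *)
Lemma aut0_shift phi : aut0_set phi <-> shift phi = 1%g.
Proof.
split=> [phi0|s1]; last first.
  have [c] := shiftP phi; rewrite s1 => lead.
  apply: (@triangular_connected _ _ _ _ _ c) => i.
  by have := lead i; rewrite translate1.
pose T := [set psi | shift psi = 1%g]%classic.
have A1 : aut0_set (1%g : alg_aut A) by exact: connected_component_refl.
suff E : (@aut0_set k A `&` T = @aut0_set k A)%classic.
  by move: phi0; rewrite -E => -[].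
apply: (component_connected (A := [set: alg_aut A]) (x := 1%g)).
- exists 1%g; split=> //; apply: (@mulgI _ (shift 1%g)).
  by rewrite -shiftM !mulg1.
- by exists T => //; exact: (open_shift (fun g => g = 1%g)).
- exists T => //; rewrite -openC; exact: (open_shift (fun g => g <> 1%g)).
Qed.

End CayleyAut.

Theorem theorem3p4 (k : closedFieldType) (char0 : [pchar k] =i pred0)
    (gT : finGroupType) :
  exists (n : nat) (I : idealr {mpoly k[n]}),
    [/\ (1 <= n)%N, monomial_ideal I & cofinite_support I] /\
    let Aut := alg_aut {ideal_quot I} in
    let Aut0 := aut0 {ideal_quot I} in
    [/\ isomorphic (quotient_group Aut0) gT,
        exists (theta : group_action gT (subg_type Aut0))
               (f : semidirect theta -> Aut),
          group_iso f /\ (forall x : subg_type Aut0, f (x, 1%g) = val x)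
      & solvable_group (subg_type Aut0)].
Proof.
exists #|gT|, (socle_ideal k (#|gT|.*2) (@cayley gT)); split.
  split; [|exact: monomial_socle_ideal|exact: cofinite_socle_ideal].
  by apply/card_gt0P; exists 1%g.
have shM := shiftM char0 (gT := gT).
have taM := @translate_autM k gT.
have taK := translate_autK char0 (gT := gT).
have ker := aut0_shift char0 (gT := gT).
split.
- exact: (@quotient_split _ _ (aut0 (socle_alg k (#|gT|.*2) (@cayley gT))) _ _ shM taK ker).
- exact: (@semidirect_split _ _ (aut0 (socle_alg k (#|gT|.*2) (@cayley gT))) _ _ shM taM taK ker).
- apply: (@solvable_triangular k _ _ _ (aut0 (socle_alg k (#|gT|.*2) (@cayley gT)))).
  move=> phi /ker s1; have [c] := shiftP char0 phi; rewrite s1 => lead; exists c => i.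
  by have := lead i; rewrite translate1.
Qed.
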